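(* Fix an equation $(f,q,w)$ as in the context. Let $K=(k_{ij})\in SL(2,\mathbb R)$, $\gamma\in(-\pi,\pi]$, and write $\lambda_n(e^{i\gamma}K)$ for the eigenvalues with boundary condition $[e^{i\gamma}K\,|\,-I]$. Let $\mathbf S_K=\begin{pmatrix}1&0&0&0\\0&0&-k_{22}&k_{12}\end{pmatrix}$ and $\mathbf V_K=\begin{pmatrix}k_{21}&k_{22}&0&0\\0&0&0&1\end{pmatrix}$. Then the problem with $\mathbf S_K$ has exactly $N$ eigenvalues if $k_{12}\ne0$ and $N-1$ if $k_{12}=0$; with $\mathbf V_K$ exactly $N$ if $f_0k_{22}-k_{21}\ne0$ and $N-1$ if $f_0k_{22}-k_{21}=0$. Furthermore: (i) if $k_{12}=0$: $\lambda_n(e^{i\gamma}K)\le\lambda_n(\mathbf S_K)\le\lambda_{n+1}(e^{i\gamma}K)$ for $0\le n\le N-2$; if $(k_{11}-f_0k_{12})k_{12}>0$: $\lambda_n(\mathbf S_K)\le\lambda_n(e^{i\gamma}K)$ for $0\le n\le N-1$ and $\lambda_n(e^{i\gamma}K)\le\lambda_{n+1}(\mathbf S_K)$ for $0\le n\le N-2$; if $(k_{11}-f_0k_{12})k_{12}<0$: $\lambda_n(e^{i\gamma}K)\le\lambda_n(\mathbf S_K)$ for $0\le n\le N-1$ and $\lambda_n(\mathbf S_K)\le\lambda_{n+1}(e^{i\gamma}K)$ for $0\le n\le N-2$; if $k_{11}-f_0k_{12}=0$: $\lambda_n(\mathbf S_K)\le\lambda_n(e^{i\gamma}K)\le\lambda_{n+1}(\mathbf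 S_K)$ for $0\le n\le N-2$; (ii) if $f_0k_{22}-k_{21}=0$: $\lambda_n(e^{i\gamma}K)\le\lambda_n(\mathbf V_K)\le\lambda_{n+1}(e^{i\gamma}K)$ for $0\le n\le N-2$; if $(k_{11}-f_0k_{12})(f_0k_{22}-k_{21})>0$: $\lambda_n(\mathbf V_K)\le\lambda_n(e^{i\gamma}K)$ for $0\le n\le N-1$ and $\lambda_n(e^{i\gamma}K)\le\lambda_{n+1}(\mathbf V_K)$ for $0\le n\le N-2$; if $(k_{11}-f_0k_{12})(f_0k_{22}-k_{21})<0$: $\lambda_n(e^{i\gamma}K)\le\lambda_n(\mathbf V_K)$ for $0\le n\le N-1$ and $\lambda_n(\mathbf V_K)\le\lambda_{n+1}(e^{i\gamma}K)$ for $0\le n\le N-2$; if $k_{11}-f_0k_{12}=0$: $\lambda_n(\mathbf V_K)\le\lambda_n(e^{i\gamma}K)\le\lambda_{n+1}(\mathbf V_K)$ for $0\le n\le N-2$.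
   Context: Let $N\ge2$ be an integer. An equation is given by real sequences $f=\{f_n\}_{n=0}^N$, $q=\{q_n\}_{n=1}^N$, $w=\{w_n\}_{n=1}^N$ with $f_n\neq0$, $w_n>0$; it is $-\nabla(f_n\Delta y_n)+q_ny_n=\lambda w_ny_n$, $1\le n\le N$, for $y=\{y_n\}_{n=0}^{N+1}$, $\Delta y_n=y_{n+1}-y_n$, $\nabla y_n=y_n-y_{n-1}$. A boundary condition $[A\,|\,B]$ (equivalently the $2\times4$ coefficient matrix $(A,B)$ of rank 2) is $A(y_0,f_0\Delta y_0)^T+B(y_N,f_N\Delta y_N)^T=0$; matrices differing by left multiplication by an invertible $2\times2$ complex matrix give the same condition. $SL(2,\mathbb R)$ is the set of real $2\times2$ matrices of determinant 1. The problem with $[e^{i\gamma}K|-I]$ has $N$ eigenvalues if $k_{11}-f_0k_{12}\neq0$ and $N-1$ otherwise. Eigenvalues ($\lambda$ with a nontrivial solution) of these self-adjoint problems are real; multiplicity = dimension of the solution space (equal to the multiplicity as a zero of the characteristic polynomial); counted with multiplicity they are ordered $\lambda_0\le\lambda_1\le\cdots$, and ''exactly $k$ eigenvalues'' counts multiplicity. *)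

(* Defs.v *)
From mathcomp Require Import all_boot all_order all_algebra.
From mathcomp Require Import complex.
From mathcomp Require Import reals trigo.
Import Order.TTheory GRing.Theory Num.Theory.
Local Open Scope ring_scope.
Local Open Scope complex_scope.

Definition expi {R : realType} (g : R) : R[i] := cos g +i* sin g.

(* The i-th linear functional (i : 'I_(N+2)) defining the boundary value
   problem for y = (y_0, ..., y_{N+1}) : rows i < N are the difference
   equations  -nabla(f_n Delta y_n) + q_n y_n - lam w_n y_n = 0  (n = i+1),
   rows N, N+1 are the two rows of the boundary condition
   (A | B) (y_0, f_0 Delta y_0, y_N, f_N Delta y_N)^T = 0. *)
Definition sl_fun {R : realType} (N : nat) (f q w : nat -> R)
    (M : 'M[R[i]]_(2, 4)) (lam : R[i]) (i : 'I_N.+2) (y : nat -> R[i]) : R[i] :=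
  if (i < N)%N then
    let n := i.+1 in
    - ((f n)%:C * (y n.+1 - y n) - (f n.-1)%:C * (y n - y n.-1))
      + (q n)%:C * y n - lam * (w n)%:C * y n
  else
    let r : 'I_2 := inord (i - N) in
    M r (inord 0) * y 0%N + M r (inord 1) * ((f 0%N)%:C * (y 1%N - y 0%N))
    + M r (inord 2) * y N + M r (inord 3) * ((f N)%:C * (y N.+1 - y N)).

(* Matrix of the linear system: row vectors u = (y_0,...,y_{N+1}) with
   u *m sys_mx = 0 are exactly the solutions of the problem. *)
Definition sys_mx {R : realType} (N : nat) (f q w : nat -> R)
    (M : 'M[R[i]]_(2, 4)) (lam : R[i]) : 'M[R[i]]_(N.+2, N.+2) :=
  \matrix_(j < N.+2, i < N.+2)
     sl_fun N f q w M lam i (fun k => ((k == j :> nat)%:R : R[i])).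

Definition eig_mult {R : realType} (N : nat) (f q w : nat -> R)
    (M : 'M[R[i]]_(2, 4)) (lam : R[i]) : nat :=
  \rank (kermx (sys_mx N f q w M lam)).

(* s is the list lambda_0 <= lambda_1 <= ... of all eigenvalues of the
   problem, counted with multiplicity (in particular all eigenvalues are
   real and there are size s of them). *)
Definition eig_list {R : realType} (N : nat) (f q w : nat -> R)
    (M : 'M[R[i]]_(2, 4)) (s : seq R) : Prop :=
  sorted <=%R s /\
  forall lam : R[i], count (fun x => x%:C == lam) s = eig_mult N f q w M lam.

Definition mx24 {R : realType} (a b c d e g h k : R) : 'M[R[i]]_(2, 4) :=
  \matrix_(r < 2, j < 4)
    (nth 0 (if r == 0 :> nat then [:: a; b; c; d] else [:: e; g; h; k]) j)%:C.

Definition bcK {R : realType} (K : 'M[R]_2) (g : R) : 'M[R[i]]_(2, 4) :=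
  row_mx (expi g *: map_mx (fun x : R => x%:C) K) (- 1%:M).

Definition bcS {R : realType} (K : 'M[R]_2) : 'M[R[i]]_(2, 4) :=
  mx24 1 0 0 0 0 0 (- K 1 1) (K 0 1).

Definition bcV {R : realType} (K : 'M[R]_2) : 'M[R[i]]_(2, 4) :=
  mx24 (K 1 0) (K 1 1) 0 0 0 0 0 1.

(* Main.v *)
Require Import Defs.
From mathcomp Require Import all_boot all_order all_algebra.
From mathcomp Require Import complex.
From mathcomp Require Import reals trigo.
From mathcomp Require Import perm spectral sesquilinear zify ring.
Import Order.TTheory GRing.Theory Num.Theory.
Local Open Scope ring_scope.
Local Open Scope complex_scope.
Local Open Scope sesquilinear_scope.
Set Implicit Arguments.
Unset Strict Implicit.
Unset Printing Implicit Defensive.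

(* Put x = (y_1, ..., y_N), u = f_0 Delta y_0 and v = f_N Delta y_N. The
   difference equations read T x + u e_1 - v e_N = lam W x with T real
   symmetric, and each of the boundary conditions can be solved as
   (u, -v) = h (x_1, x_N) with h Hermitian, or the same up to a Lagrange
   multiplier on a hyperplane l(x_1, x_N) = 0. Every problem is therefore the
   Hermitian pencil (T + h, W) on C^N or on a hyperplane, hence has N or N - 1
   eigenvalues. With c = k11 - f0 k12 and d = f0 k22 - k21 one finds
     h_K - h_S = |f0 k12 x_1 - e^(-i gamma) x_N|^2 / (c k12),
     h_K - h_V = |f0 x_1 - d e^(-i gamma) x_N|^2 / (c d),
   a rank one perturbation whose sign decides the direction of the
   interlacing; in the degenerate cases one form is the restriction of the
   other to a hyperplane, and Cauchy interlacing applies. *)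

(** * Hermitian pencils *)

Lemma mul_trmxC {C : numClosedFieldType} m n p (A : 'M[C]_(m, n))
    (B : 'M[C]_(n, p)) : (A *m B)^t* = B^t* *m A^t*.
Proof. by rewrite trmx_mul map_mxM. Qed.

(** The kernel is the direct sum of the coordinate lines on which [d] vanishes. *)
Lemma rank_ker_diag (F : fieldType) n (d : 'rV[F]_n) :
  \rank (kermx (diag_mx d)) = #|[pred i | d 0 i == 0]|.
Proof.
have -> : \rank (kermx (diag_mx d)) =
    \rank (\sum_(i | d 0 i == 0) <<delta_mx 0 i : 'rV[F]_n>>)%MS.
  apply/eqmx_rank/andP; split; last first.
    apply/sumsmx_subP => i /eqP di0; rewrite genmxE; apply/sub_kermxP.
    apply/rowP => j; rewrite mul_mx_diag !mxE.
    by case: (j =P i) => [->|]; rewrite ?di0 ?mulr0 ?mul0r.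
  apply/rV_subP => v /sub_kermxP; rewrite mul_mx_diag => /rowP vd.
  rewrite (row_sum_delta v) summx_sub // => j _.
  have [vj0|vj0] := eqVneq (v 0 j) 0; first by rewrite vj0 scale0r sub0mx.
  have dj0 : d 0 j == 0.
    by have /eqP := vd j; rewrite !mxE mulf_eq0 (negPf vj0).
  by rewrite scalemx_sub // (sumsmx_sup j) // genmxE.
rewrite (mxdirectP _) /=; last exact: mxdirect_delta.
rewrite -sum1_card; apply: eq_bigr => i _.
by rewrite genmxE mxrank_delta.
Qed.

Section HermitianPencil.
Variable R : rcfType.
Local Notation C := R[i].

Definition cdiag {m} (s : seq R) : 'M[C]_m := diag_mx (\row_i (nth 0 s i)%:C).

Lemma cdiag_form m (s : seq R) (b : 'rV[C]_m) :
  (b *m cdiag s *m b^t*) 0 0 = \sum_(k < m) (nth 0 s k)%:C * `|b 0 k| ^+ 2.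
Proof.
rewrite mxE; apply: eq_bigr => k _.
by rewrite mul_mx_diag !mxE normCK; ring.
Qed.

(** Spectral theorem with increasing eigenvalues, obtained by permuting the rows of the spectral
    matrix along with them; positions in [s] are then min-max indices. *)
Lemma hermitian_diag m (A : 'M[C]_m) : A^t* = A ->
  exists (P : 'M[C]_m) (s : seq R), [/\ P *m P^t* = 1%:M,
    P *m A *m P^t* = cdiag s, sorted <=%R s & size s = m].
Proof.
move=> hA; have Aherm : A \is hermsymmx.
  by apply/is_hermitianmxP; rewrite expr0 scale1r hA.
have /hermitian_normalmx/orthomx_spectralP := Aherm.
have /hermitian_spectral_diag_real/mxOverP := Aherm.
set Q := spectralmx A; set d := spectral_diag A => d_real AE.
have Qu : Q \is unitarymx by exact: spectral_unitarymx.
pose t := [tuple complex.Re (d 0 i) | i < m].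
have /tuple_permP[p sE] : perm_eq (sort <=%R t) t by rewrite perm_sort.
exists (row_perm p Q), (sort <=%R t).
have rpE (B : 'M[C]_m) :
    row_perm p Q *m B *m (row_perm p Q)^t* =
    \matrix_(i, j) (Q *m B *m Q^t*) (p i) (p j).
  apply/matrixP => i j.
  rewrite !mxE; apply: eq_bigr => k _; rewrite !mxE; congr (_ * _).
  by apply: eq_bigr => l _; rewrite !mxE.
split; last by rewrite size_sort size_tuple.
- rewrite -[X in X *m _]mulmx1 rpE mulmx1 (unitarymxP Qu).
  by apply/matrixP => i j; rewrite !mxE (inj_eq perm_inj).
- rewrite rpE AE invmx_unitary // !mulmxA (unitarymxP Qu) mul1mx.
  rewrite -mulmxA (unitarymxP Qu) mulmx1.
  apply/matrixP => i j; rewrite !mxE (inj_eq perm_inj); congr (_ *+ _).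
  rewrite sE (nth_map i) ?size_enum_ord // nth_ord_enum tnth_mktuple.
  by rewrite RRe_real.
- by apply: sort_sorted; exact: le_total.
Qed.

(** Gram-Schmidt on the rows of [B *m D], followed by the inverse of [D], gives a basis of the row
    space of [B] that is orthonormal for the weight; a unitary change of this basis diagonalizes the
    compressed form. *)
Lemma pencil_diag m n (B : 'M[C]_(m, n)) (D H : 'M[C]_n) :
  D \in unitmx -> H^t* = H -> row_free B ->
  exists (P : 'M[C]_(m, n)) (s : seq R), [/\ (P :=: B)%MS,
    P *m (D *m D^t*) *m P^t* = 1%:M, P *m H *m P^t* = cdiag s,
    sorted <=%R s & size s = m].
Proof.
move=> Du hH Bf.
have BDf : row_free (B *m D).
  by rewrite /row_free mxrankMfree ?row_free_unit.
pose S := schmidt (B *m D).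
have SE : (S :=: B *m D)%MS by exact: eqmx_schmidt_free.
have Su : S *m S^t* = 1%:M.
  by apply/unitarymxP/schmidt_unitarymx; rewrite -(eqP Bf) rank_leq_col.
pose Y := S *m invmx D.
have [|U [s [Uu sE ss sz]]] := @hermitian_diag _ (Y *m H *m Y^t*).
  by rewrite !mul_trmxC !trmxCK hH !mulmxA.
have Uunit : U \in unitmx by case/mulmx1_unit: Uu.
exists (U *m Y), s; split=> //.
- apply: eqmx_trans (eqmxMfull _ _) _; first by rewrite row_full_unit.
  by rewrite /Y; apply: eqmx_trans (eqmxMr _ SE) _; rewrite mulmxK.
- rewrite mulmxA -(mulmxA _ (D^t*)) -mul_trmxC.
  have -> : U *m Y *m D = U *m S by rewrite -mulmxA mulmxKV.
  by rewrite mul_trmxC -(mulmxA U) (mulmxA S) Su mul1mx.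
- by rewrite mul_trmxC -sE !mulmxA.
Qed.

(* The rows of [P] are [W]-orthonormal and diagonalize the Hermitian form of
   [H] on their span; for [s] sorted this is the spectral resolution of the
   pencil [H - lam W] compressed to that span. *)
Definition pencil_basis {m n} (W H : 'M[C]_n) (P : 'M[C]_(m, n)) (s : seq R) :=
  [/\ P *m W *m P^t* = 1%:M, P *m H *m P^t* = cdiag s,
      sorted <=%R s & size s = m].

Section Coordinates.
Variables (m n : nat) (W H : 'M[C]_n) (P : 'M[C]_(m, n)) (s : seq R).
Hypothesis PP : pencil_basis W H P s.
Variables (b : 'rV[C]_m) (i : nat).
Hypothesis im : (i < m)%N.
Local Notation x := (b *m P).

Lemma pencil_formH :
  (x *m H *m x^t*) 0 0 = \sum_(k < m) (nth 0 s k)%:C * `|b 0 k| ^+ 2.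
Proof.
case: PP => _ dH _ _.
by rewrite -cdiag_form -dH mul_trmxC !mulmxA.
Qed.

Lemma pencil_formW : (x *m W *m x^t*) 0 0 = \sum_(k < m) `|b 0 k| ^+ 2.
Proof.
case: PP => dW _ _ _.
have -> : x *m W *m x^t* = b *m (P *m W *m P^t* ) *m b^t*.
  by rewrite mul_trmxC !mulmxA.
by rewrite dW mulmx1 mxE; apply: eq_bigr => k _; rewrite !mxE normCK.
Qed.

Lemma pencil_form_ge : (forall k : 'I_m, (k < i)%N -> b 0 k = 0) ->
  (nth 0 s i)%:C * (x *m W *m x^t*) 0 0 <= (x *m H *m x^t*) 0 0.
Proof.
move=> b0; rewrite pencil_formH pencil_formW mulr_sumr ler_sum // => k _.
have [ki|ik] := ltnP k i; first by rewrite b0 // normr0 expr0n !mulr0.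
case: PP => _ _ ss sz; rewrite ler_wpM2r ?exprn_ge0 // lecR.
by rewrite (le_sorted_leq_nth 0 ss) // inE sz.
Qed.

Lemma pencil_form_le : (forall k : 'I_m, (i < k)%N -> b 0 k = 0) ->
  (x *m H *m x^t*) 0 0 <= (nth 0 s i)%:C * (x *m W *m x^t*) 0 0.
Proof.
move=> b0; rewrite pencil_formH pencil_formW mulr_sumr ler_sum // => k _.
have [ik|ki] := ltnP i k; first by rewrite b0 // normr0 expr0n !mulr0.
case: PP => _ _ ss sz; rewrite ler_wpM2r ?exprn_ge0 // lecR.
by rewrite (le_sorted_leq_nth 0 ss) // inE sz.
Qed.

End Coordinates.

Lemma pencil_basis_free m n (W H : 'M[C]_n) (P : 'M[C]_(m, n)) s :
  pencil_basis W H P s -> row_free P.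
Proof.
case=> dW _ _ _; apply/row_freeP; exists (W *m P^t* ).
by rewrite mulmxA.
Qed.

(** Courant-Fischer argument: the span of the rows of [P1] from [i] on, that of the first [j.+1]
    rows of [P2] and the kernel of [L], of codimension at most [c], share a nonzero vector by the
    dimension count, and there s1_i W <= H1 <= H2 <= s2_j W. *)
Lemma pencil_nth_le m1 m2 n c (W H1 H2 : 'M[C]_n) (P1 : 'M[C]_(m1, n))
    (P2 : 'M[C]_(m2, n)) (s1 s2 : seq R) (L : 'M[C]_(n, c)) (i j : nat) :
  (forall x : 'rV[C]_n, x != 0 -> 0 < (x *m W *m x^t*) 0 0) ->
  pencil_basis W H1 P1 s1 -> pencil_basis W H2 P2 s2 ->
  (forall x : 'rV[C]_n, (x <= P1)%MS -> (x <= P2)%MS -> x *m L = 0 ->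
     (x *m H1 *m x^t*) 0 0 <= (x *m H2 *m x^t*) 0 0) ->
  (i < m1)%N -> (j < m2)%N -> (n + c < (m1 - i) + j.+1)%N ->
  nth 0 s1 i <= nth 0 s2 j.
Proof.
move=> Wpos B1 B2 H12 im jm dims.
pose E1 : 'M[C]_(m1, n) := copid_mx i *m P1.
pose E2 : 'M[C]_(m2, n) := pid_mx j.+1 *m P2.
have rE1 : \rank E1 = (m1 - i)%N.
  rewrite mxrankMfree ?(pencil_basis_free B1) //.
  by rewrite rank_copid_mx // ltnW.
have rE2 : \rank E2 = j.+1.
  rewrite mxrankMfree ?(pencil_basis_free B2) //.
  by rewrite rank_pid_mx.
have : (E1 :&: E2 :&: kermx L)%MS != 0.
  rewrite -mxrank_eq0 -lt0n.
  have := mxrank_sum_cap E1 E2; have := mxrank_sum_cap (E1 :&: E2)%MS (kermx L).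
  have := rank_leq_col (E1 + E2)%MS; have := rank_leq_col L.
  have := rank_leq_col ((E1 :&: E2) + kermx L)%MS.
  rewrite mxrank_ker rE1 rE2; lia.
case/rowV0Pn => x; rewrite !sub_capmx => /andP[/andP[xE1 xE2] /sub_kermxP xL] x0.
have xP1 : (x <= P1)%MS by apply: submx_trans xE1 _; exact: submxMl.
have xP2 : (x <= P2)%MS by apply: submx_trans xE2 _; exact: submxMl.
have h12 := H12 x xP1 xP2 xL; have w0 := Wpos x x0.
have ge1 : (nth 0 s1 i)%:C * (x *m W *m x^t*) 0 0 <= (x *m H1 *m x^t*) 0 0.
  case/submxP: xE1 => a ->; rewrite mulmxA.
  apply: (pencil_form_ge B1) => // k ki.
  rewrite mulmxBr mulmx1 !mxE (bigD1 k) //= !mxE eqxx ki mulr1 big1 ?addr0 ?subrr //.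
  by move=> l lk; rewrite !mxE; case: eqP => [/val_inj/eqP|]; rewrite ?(negPf lk) ?mulr0.
have le2 : (x *m H2 *m x^t*) 0 0 <= (nth 0 s2 j)%:C * (x *m W *m x^t*) 0 0.
  case/submxP: xE2 => a ->; rewrite mulmxA.
  apply: (pencil_form_le B2) => // k jk.
  rewrite !mxE big1 // => l _; rewrite !mxE ltnS.
  by case: eqP => [->|]; rewrite ?mulr0 // leqNgt jk mulr0.
have := le_trans ge1 (le_trans h12 le2).
by rewrite ler_pM2r // lecR.
Qed.

(* A critical point of the form of [H] on the space [x *m l = 0] is a solution
   of the Lagrange multiplier equation [x *m (H - lam W) = t *m l^t*]. *)
Lemma pencil_multiplicity m n c p r (W H : 'M[C]_n) (P : 'M[C]_(m, n)) s
    (l : 'M[C]_(n, c)) (lam : C) (S : 'M[C]_(p, r)) (sel : 'M[C]_(p, n)) :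
  pencil_basis W H P s -> (P :=: kermx l)%MS ->
  (forall y : 'rV[C]_p, y *m S = 0 -> y *m sel *m l = 0 /\
     exists t : 'rV[C]_c, y *m sel *m (H - lam *: W) = t *m l^t*) ->
  (forall y : 'rV[C]_p, y *m S = 0 -> y *m sel = 0 -> y = 0) ->
  (forall (x : 'rV[C]_n) (t : 'rV[C]_c), x *m l = 0 ->
     x *m (H - lam *: W) = t *m l^t* ->
     exists2 y : 'rV[C]_p, y *m S = 0 & y *m sel = x) ->
  count (fun z => z%:C == lam) s = \rank (kermx S).
Proof.
move=> B Pl solx inj xsol; have Pf := pencil_basis_free B.
case: B => dW dH _ sz.
pose G : 'M[C]_m := cdiag s - lam%:M.
have GE : G = P *m (H - lam *: W) *m P^t*.
  by rewrite mulmxBr mulmxBl dH -scalemxAr -scalemxAl dW scalemx1.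
have Pl0 : P *m l = 0 by apply/sub_kermxP; rewrite -Pl.
have lP0 : l^t* *m P^t* = 0.
  by rewrite -mul_trmxC Pl0 linear0 map_mx0.
(* Since the rows of [P] are [W]-orthonormal, [phi] sends a solution to the coordinates of its
   selected part in these rows. *)
pose phi := sel *m W *m P^t*.
have coord (y : 'rV_p) : y *m S = 0 -> y *m phi *m P = y *m sel.
  case/solx => yl _; have : (y *m sel <= P)%MS by rewrite Pl; apply/sub_kermxP.
  case/submxP => b yE; rewrite /phi !mulmxA yE.
  transitivity (b *m (P *m W *m P^t* ) *m P); first by rewrite !mulmxA.
  by rewrite dW mulmx1.
have -> : \rank (kermx S) = \rank (kermx S *m phi).
  apply/esym/mxrank_injP/rowV0P => y; rewrite sub_capmx.
  case/andP=> /sub_kermxP yS /sub_kermxP y0; apply: inj => //.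
  by rewrite -coord // y0 mul0mx.
have -> : \rank (kermx S *m phi) = \rank (kermx G).
  apply/eqmx_rank/andP; split; apply/rV_subP => a.
    case/submxP => z ->; rewrite mulmxA; set y := z *m _.
    have yS : y *m S = 0 by rewrite -mulmxA mulmx_ker mulmx0.
    apply/sub_kermxP; rewrite GE mulmxA (mulmxA (y *m phi)) coord //.
    by have [_ [t ->]] := solx y yS; rewrite -mulmxA lP0 mulmx0.
  move/sub_kermxP => aG.
  have xl : a *m P *m l = 0 by rewrite -mulmxA Pl0 mulmx0.
  have : (a *m P *m (H - lam *: W) <= kermx (P^t* ))%MS.
    by apply/sub_kermxP; rewrite -aG GE !mulmxA.
  (* By dimension, the kernel of [P^t*] is the row space of [l^t*]; this produces the Lagrange
     multiplier. *)
  have <- : (l^t* :=: kermx (P^t* ))%MS.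
    apply/eqmxP; rewrite -(geq_leqif (mxrank_leqif_eq _)); last exact/sub_kermxP.
    rewrite mxrank_ker !mxrank_map !mxrank_tr Pl mxrank_ker subKn //.
    exact: rank_leq_row.
  case/submxP => t xE; have [y yS yx] := xsol _ t xl xE.
  have -> : a = y *m phi.
    apply: (row_free_inj Pf); by rewrite coord.
  by rewrite submxMr //; apply/sub_kermxP.
have -> : G = diag_mx (\row_i ((nth 0 s i)%:C - lam)).
  rewrite /G /cdiag -diag_const_mx -linearB /=; congr diag_mx.
  by apply/rowP => k; rewrite !mxE.
rewrite rank_ker_diag -sum1_card -sum1_count (big_nth 0) sz big_mkord.
by apply: eq_bigl => k; rewrite !inE mxE subr_eq0.
Qed.

End HermitianPencil.

(** * Reduction of the boundary value problem *)

Lemma conjC_real_complex (R : rcfType) (r : R) : (r%:C : R[i])^*%R = r%:C.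
Proof. by apply: conj_Creal; rewrite complex_real. Qed.

Section LinearFunctionals.
Variables (C : comNzRingType) (p : nat).

(** A combination of the indicator sequences that build the system matrix, so that linearity of a
    functional evaluates a row times that matrix; it vanishes from index [p] on. *)
Definition seq_of_row (y : 'rV[C]_p) (k : nat) : C :=
  \sum_(j < p) y 0 j * (k == j :> nat)%:R.

Lemma seq_of_rowE (y : 'rV[C]_p) (j : 'I_p) : seq_of_row y j = y 0 j.
Proof.
rewrite /seq_of_row (bigD1 j) //= eqxx mulr1 big1 ?addr0 // => k kj.
by rewrite eq_sym (inj_eq val_inj) (negPf kj) mulr0.
Qed.

Lemma mul_functional_mx (q : nat) (F : 'I_q -> (nat -> C) -> C) :
  (forall i a y z, F i (fun k => a * y k + z k) = a * F i y + F i z) ->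
  (forall i y z, y =1 z -> F i y = F i z) ->
  forall (y : 'rV[C]_p) i,
    (y *m \matrix_(j, i) F i (fun k => (k == j :> nat)%:R)) 0 i
      = F i (seq_of_row y).
Proof.
move=> Flin Fext y i; rewrite mxE /seq_of_row.
elim: (index_enum _) => [|j r IHr].
  (* That the functional vanishes at 0 follows from linearity applied to 0 = -1 * 0 + 0. *)
  rewrite big_nil; pose z (k : nat) : C := 0.
  rewrite -(Fext i (fun k => -1 * z k + z k)) ?Flin ?mulN1r ?addNr // => k.
  by rewrite big_nil mulr0 addr0.
rewrite big_cons IHr !mxE -Flin; apply: Fext => k.
by rewrite big_cons.
Qed.

End LinearFunctionals.

Section DiscreteSturmLiouville.
Variables (R : realType) (n : nat) (f q w : nat -> R).
Local Notation N := n.+2.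
Local Notation C := R[i].
Hypothesis fN0 : forall k, (k <= N)%N -> f k != 0.
Hypothesis w_gt0 : forall k, (1 <= k <= N)%N -> 0 < w k.

Lemma mul_sys_mx (M : 'M[C]_(2, 4)) lam (y : 'rV[C]_N.+2) i :
  (y *m sys_mx N f q w M lam) 0 i = sl_fun N f q w M lam i (seq_of_row y).
Proof.
apply: (@mul_functional_mx _ _ _ (sl_fun N f q w M lam)) => {}i.
  by move=> a u z; rewrite /sl_fun; case: ifP => _ /=; ring.
by move=> u z uz; rewrite /sl_fun; case: ifP => _; rewrite /= !uz.
Qed.

(* The difference operator on (y_1, ..., y_N), with the boundary fluxes
   [f_0 Delta y_0] and [f_N Delta y_N] left out; indices are shifted to start
   from 0. *)
Definition free_fun (i : 'I_N) (y : nat -> C) : C :=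
  (if (i < n.+1)%N then (f i.+1)%:C * (y i - y i.+1) else 0)
  + (if (0 < i)%N then (f i)%:C * (y i - y i.-1) else 0) + (q i.+1)%:C * y i.

Definition free_mx : 'M[C]_N :=
  \matrix_(j, i) free_fun i (fun k => (k == j :> nat)%:R).

Lemma mul_free_mx (x : 'rV[C]_N) i :
  (x *m free_mx) 0 i = free_fun i (seq_of_row x).
Proof.
apply: (mul_functional_mx (F := free_fun)) => {}i.
  by move=> a u z; rewrite /free_fun; do 2!case: ifP => _; ring.
by move=> u z uz; rewrite /free_fun; do 2!case: ifP => _; rewrite /= !uz.
Qed.

(** Off the diagonal only neighbours [k], [k.+1] interact, in both directions with the real
    coefficient [- f k.+1]. *)
Lemma free_mx_herm : free_mx^t* = free_mx.
Proof.
apply/matrixP => i j; rewrite !mxE /free_fun.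
rewrite !rmorphD /= !(fun_if Num.conj) !rmorphM !rmorphB /= !conjC_real_complex.
rewrite !rmorph_nat ?rmorph0; case: i j => [i iN] [j jN] /=.
have sym a b : (a < b)%N -> (b < N)%N ->
    [/\ (a.-1 == b) = false, (b.+1 == a) = false & (a < n.+1)%N /\ (0 < b)%N].
  by move=> ab bN; split; last split; lia.
have E a b : (a < b)%N -> (a.+1 == b) = (b.-1 == a) by lia.
case: (ltngtP i j) => [ij|ji|->]; last by [].
- have [-> -> [-> ->]] := sym _ _ ij jN; rewrite E //.
  by case: eqVneq => [<-|_]; rewrite ?prednK ?(leq_trans _ ij) //=;
    do !case: ifP => _; ring.
- have [-> -> [-> ->]] := sym _ _ ji iN; rewrite E //.
  by case: eqVneq => [<-|_]; rewrite ?prednK ?(leq_trans _ ji) //=;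
    do !case: ifP => _; ring.
Qed.

(** The square root supplies the factor [D] that [pencil_diag] asks for. *)
Definition weight_sqrt : 'M[C]_N := diag_mx (\row_i (Num.sqrt (w i.+1))%:C).
Definition weight_mx : 'M[C]_N := weight_sqrt *m weight_sqrt^t*.

Lemma weight_sqrt_unit : weight_sqrt \in unitmx.
Proof.
rewrite unitmxE det_diag unitfE; apply/prodf_neq0 => i _.
by rewrite mxE fmorph_eq0 gt_eqF // sqrtr_gt0 w_gt0 //= ltn_ord.
Qed.

Lemma mul_weight_mx (x : 'rV[C]_N) i :
  (x *m weight_mx) 0 i = (w i.+1)%:C * x 0 i.
Proof.
rewrite mulmxA tr_diag_mx map_diag_mx !mul_mx_diag !mxE /= conjC_real_complex.
rewrite -mulrA -rmorphM /= -expr2 sqr_sqrtr 1?mulrC // ltW // w_gt0 //=.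
Qed.

Lemma weight_pos (x : 'rV[C]_N) : x != 0 -> 0 < (x *m weight_mx *m x^t*) 0 0.
Proof.
move=> x0; set z := x *m weight_sqrt.
have -> : x *m weight_mx *m x^t* = z *m z^t* by rewrite mul_trmxC !mulmxA.
rewrite -dotmxE lt_def dnorm_ge0 dnorm_eq0 andbT.
apply: contraNneq x0 => /(congr1 (mulmx^~ (invmx weight_sqrt))) /=.
by rewrite mulmxK ?weight_sqrt_unit // mul0mx => ->.
Qed.

(* [x *m ends = (x_1, x_N)] *)
Definition ends : 'M[C]_(N, 2) :=
  \matrix_(j, k) (j == (if k == 0 then ord0 else ord_max))%:R.

Lemma mul_ends (x : 'rV[C]_N) k :
  (x *m ends) 0 k = x 0 (if k == 0 then ord0 else ord_max).
Proof.
rewrite mxE; set e := (if _ then _ else _).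
rewrite (bigD1 e) //= mxE eqxx mulr1 big1 ?addr0 // => j je.
by rewrite mxE (negPf je) mulr0.
Qed.

Lemma ends_trC : ends^t* = ends^T.
Proof. by apply/matrixP => i j; rewrite !mxE rmorph_nat. Qed.

Lemma mul_ends_tr (g : 'rV[C]_2) i :
  (g *m ends^T) 0 i = (i == ord0)%:R * g 0 0 + (i == ord_max)%:R * g 0 1.
Proof.
rewrite mxE !big_ord_recl big_ord0 !mxE /= addr0 ![g _ _ * _]mulrC.
by rewrite (_ : lift ord0 ord0 = 1) //; exact/val_inj.
Qed.

(** The first and last positions are distinct because N >= 2, so both components of [g] can be read
    off. *)
Lemma mul_ends_tr_eq0 (g : 'rV[C]_2) : g *m ends^T = 0 -> g = 0.
Proof.
move=> /rowP g0; have := g0 ord0; have := g0 ord_max.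
rewrite !mul_ends_tr !mxE /= eqxx !mul0r !mul1r add0r addr0 => g1 g2.
apply/rowP => k; rewrite mxE.
case: k => [[|[|//]] k2].
  by rewrite (_ : Ordinal k2 = 0) //; exact/val_inj.
by rewrite (_ : Ordinal k2 = 1) //; exact/val_inj.
Qed.

Definition form_mx (h : 'M[C]_2) : 'M[C]_N := free_mx + ends *m h *m ends^T.

Lemma form_mx_herm h : h^t* = h -> (form_mx h)^t* = form_mx h.
Proof.
move=> hh; rewrite /form_mx linearD map_mxD /= free_mx_herm !mul_trmxC hh.
by rewrite ends_trC -ends_trC trmxCK ends_trC mulmxA.
Qed.

Definition inner : 'M[C]_(N.+2, N) := \matrix_(j, k) (j == k.+1 :> nat)%:R.

Lemma mul_inner (y : 'rV[C]_N.+2) (k : 'I_N) :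
  (y *m inner) 0 k = seq_of_row y k.+1.
Proof.
rewrite mxE; apply: eq_bigr => j _.
by rewrite mxE eq_sym.
Qed.

Lemma seq_of_row_inner (y : 'rV[C]_N.+2) (k : nat) : (k < N)%N ->
  seq_of_row (y *m inner) k = seq_of_row y k.+1.
Proof. by move=> kN; rewrite -(mul_inner y (Ordinal kN)) -seq_of_rowE. Qed.

(* The boundary fluxes; the second one has the sign with which it enters the
   last difference equation. *)
Definition flux (y : nat -> C) : 'rV[C]_2 :=
  \row_k (if k == 0 then (f 0%N)%:C * (y 1%N - y 0%N)
          else - ((f N)%:C * (y N.+1 - y N))).

Lemma sl_fun_inner M lam (y : 'rV[C]_N.+2) (i : 'I_N) (i' : 'I_N.+2) :
  i' = i :> nat ->
  sl_fun N f q w M lam i' (seq_of_row y) =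
  (y *m inner *m (free_mx - lam *: weight_mx)
    + flux (seq_of_row y) *m ends^T) 0 i.
Proof.
move=> i'i; rewrite /sl_fun i'i ltn_ord mulmxBr -scalemxAr.
rewrite [RHS]mxE mul_ends_tr [X in _ = X + _]mxE [X in _ = _ + X + _]mxE.
rewrite [X in _ = _ - X + _]mxE.
rewrite mul_weight_mx mul_free_mx mul_inner /free_fun !mxE /=.
have pN : (i.-1 < N)%N by rewrite (leq_ltn_trans (leq_pred _)).
rewrite (seq_of_row_inner _ (ltn_ord i)) (seq_of_row_inner _ pN) {pN}.
(* The first and last equations take their terms in y_0 and y_{N+1} from [flux]. *)
case: i i'i => [i iN] _ /=; rewrite -!(inj_eq val_inj) /=.
have [iN1|iN1] := ltnP i n.+1.
  rewrite seq_of_row_inner //.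
  rewrite [_ == n.+1]ltn_eqF //; case: i iN1 iN => [|i] iN1 iN /=; first ring.
  by ring.
have -> : i = n.+1 by lia.
rewrite eqxx /=; ring.
Qed.

(* [h] is the boundary form and [l] the (possibly zero) constraint obtained by
   solving the boundary condition for the fluxes [u = f_0 Delta y_0] and
   [v = f_N Delta y_N] in terms of [y_1 = p + u / f_0] and [y_N = z]; the
   multiplier [t] absorbs the flux that the constraint leaves free. *)
Definition bc_form (M : 'M[C]_(2, 4)) (h : 'M[C]_2) (l : 'cV[C]_2) :=
  forall p u z v : C,
    (forall r : 'I_2, M r (inord 0) * p + M r (inord 1) * u
       + M r (inord 2) * z + M r (inord 3) * v = 0) <->
    (let b : 'rV_2 := \row_k (if k == 0 then p + u / (f 0%N)%:C else z) in
     b *m l = 0 /\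
     exists t : 'rV_1, \row_k (if k == 0 then u else - v) = b *m h + t *m l^t*).

Lemma sl_fun_bc M lam (y : nat -> C) :
  (forall i : 'I_N.+2, (N <= i)%N -> sl_fun N f q w M lam i y = 0) <->
  (forall r : 'I_2, M r (inord 0) * y 0%N
     + M r (inord 1) * ((f 0%N)%:C * (y 1%N - y 0%N)) + M r (inord 2) * y N
     + M r (inord 3) * ((f N)%:C * (y N.+1 - y N)) = 0).
Proof.
split=> bc r.
  have := bc (inord (N + r)); rewrite /sl_fun inordK; last first.
    by rewrite -[in X in (_ < X)%N]addn2 ltn_add2l.
  rewrite leq_addr ltnNge leq_addr /= => /(_ isT); rewrite addKn.
  by rewrite inord_val.
by move=> Nr; rewrite /sl_fun ltnNge Nr /= bc.
Qed.

(** The first N columns of the system are the difference equations; the last two are the boundary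
    condition, which [bc_form] turns into a constraint on the end values and a formula for the
    fluxes. *)
Lemma sys_kerP M lam h l (y : 'rV[C]_N.+2) : bc_form M h l ->
  let Y := seq_of_row y in let x := y *m inner in
  y *m sys_mx N f q w M lam = 0 <->
  [/\ x *m (free_mx - lam *: weight_mx) + flux Y *m ends^T = 0,
      x *m (ends *m l) = 0 &
      exists t : 'rV_1, flux Y = x *m ends *m h + t *m l^t*].
Proof.
move=> Mhl Y x.
have f0 : (f 0%N)%:C != 0 :> C by rewrite fmorph_eq0 fN0.
have bE : \row_k (if k == 0 then Y 0%N + (f 0%N)%:C * (Y 1%N - Y 0%N) / (f 0%N)%:C
    else Y N) = x *m ends.
  apply/rowP => k; rewrite mul_ends mul_inner mxE.
  by case: (k == 0) => //=; rewrite mulrAC mulfV // mul1r addrC subrK.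
have := Mhl (Y 0%N) ((f 0%N)%:C * (Y 1%N - Y 0%N)) (Y N) ((f N)%:C * (Y N.+1 - Y N)).
rewrite /= bE -/(flux Y) -mulmxA => bc.
have := sl_fun_bc M lam Y => slbc.
split=> [/rowP y0|[e0 l0 t0]].
  have [l0 t0] : x *m (ends *m l) = 0 /\
      exists t : 'rV_1, flux Y = x *m ends *m h + t *m l^t*.
    apply/bc/slbc => i _; by rewrite -(mul_sys_mx M lam y) y0 mxE.
  split=> //; apply/rowP => i.
  have le : (N <= N.+2)%N by lia.
  by rewrite -(@sl_fun_inner M lam y i (widen_ord le i)) // -mul_sys_mx y0 !mxE.
apply/rowP => i; rewrite mul_sys_mx mxE.
have [iN|Ni] := ltnP i N; last by move: i Ni; apply/slbc/bc.
by rewrite (sl_fun_inner M lam y (i := Ordinal iN)) // e0 mxE.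
Qed.

Lemma sl_spectrum M h l : h^t* = h -> bc_form M h l ->
  exists (s : seq R) (P : 'M[C]_(N - (l != 0), N)),
    [/\ eig_list N f q w M s, pencil_basis weight_mx (form_mx h) P s &
        (P :=: kermx (ends *m l))%MS].
Proof.
move=> hh Mhl.
(* The Boolean counts as a number: a nonzero constraint costs one dimension. *)
have rkl : \rank (ends *m l) = (l != 0).
  have [->|l0] := eqVneq l 0; first by rewrite mulmx0 mxrank0.
  apply/eqP; rewrite eqn_leq rank_leq_col lt0n mxrank_eq0.
  apply: contraNneq l0 => /(congr1 trmx); rewrite trmx_mul trmx0.
  by move=> /mul_ends_tr_eq0/(congr1 trmx); rewrite trmxK trmx0 => ->.
have mE : \rank (kermx (ends *m l)) = (N - (l != 0%R))%N by rewrite mxrank_ker rkl.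
rewrite -mE; have Bf := row_base_free (kermx (ends *m l)).
have [P [s [PB dW dH ss sz]]] := pencil_diag weight_sqrt_unit (form_mx_herm hh) Bf.
have Pl : (P :=: kermx (ends *m l))%MS.
  by apply: eqmx_trans PB _; exact: eq_row_base.
have PP : pencil_basis weight_mx (form_mx h) P s by split.
have f0 : (f 0%N)%:C != 0 :> C by rewrite fmorph_eq0 fN0.
have fN : (f N)%:C != 0 :> C by rewrite fmorph_eq0 fN0.
have HE lam (x : 'rV[C]_N) : x *m (form_mx h - lam *: weight_mx) =
    x *m (free_mx - lam *: weight_mx) + x *m ends *m h *m ends^T.
  by rewrite /form_mx addrAC mulmxDr !mulmxA.
have lE (t : 'rV[C]_1) : t *m (ends *m l)^t* = t *m l^t* *m ends^T.
  by rewrite mul_trmxC ends_trC mulmxA.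
exists s, P; split=> //; split=> // lam.
apply: (pencil_multiplicity (sel := inner) PP Pl).
(* Inserting the fluxes into the difference equations gives the Lagrange equation with multiplier
   [- t]. *)
- move=> y /(sys_kerP _ _ Mhl)[e0 l0 [t tE]]; split=> //; exists (- t).
  apply/eqP; rewrite HE lE !mulNmx -addr_eq0 -addrA -mulmxDl -tE.
  exact/eqP.
(* If y_1, ..., y_N vanish, so do the fluxes, and then y_0 = y_{N+1} = 0 because f_0 and f_N are
   nonzero. *)
- move=> y /(sys_kerP _ _ Mhl)[e0 _ _] x0.
  move: e0; rewrite x0 mul0mx add0r => /mul_ends_tr_eq0/rowP g0.
  have Y0 k : (0 < k <= N)%N -> seq_of_row y k = 0.
    case: k => // k kN.
    by rewrite -(mul_inner y (Ordinal kN)) x0 mxE.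
  have g00 := g0 0; have g01 := g0 1.
  apply/rowP => j; rewrite -seq_of_rowE mxE; case: j => j jN /=.
  have [->|j0] := posnP j.
    move: g00; rewrite !mxE /= => /eqP; rewrite mulf_eq0 (negPf f0) /=.
    by rewrite (Y0 1%N) // sub0r oppr_eq0 => /eqP.
  have [jN1|Nj] := leqP j N; first by rewrite Y0 // j0.
  have -> : j = N.+1 by lia.
  move: g01; rewrite !mxE /= => /eqP; rewrite oppr_eq0 mulf_eq0 (negPf fN) /=.
  by rewrite (Y0 N) ?leqnn // subr0 => /eqP.
- move=> x t xl xE.
  (* The Lagrange equation dictates the fluxes [g], from which y_0 and y_{N+1} are solved; both
     quotients are subtracted because the second flux carries a reversed sign. *)
  pose g := x *m ends *m h - t *m l^t*.
  pose y : 'rV[C]_N.+2 := \row_j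
    if j == 0 :> nat then x 0 ord0 - g 0 0 / (f 0%N)%:C
    else if j == N.+1 :> nat then x 0 ord_max - g 0 1 / (f N)%:C
    else seq_of_row x j.-1.
  have yx : y *m inner = x.
    apply/rowP => k; rewrite mul_inner.
    have kN : (k.+1 < N.+2)%N by rewrite !ltnS ltnW.
    rewrite (seq_of_rowE y (Ordinal kN)) mxE /= eqSS ltn_eqF //.
    by rewrite seq_of_rowE.
  exists y => //; apply/(sys_kerP _ _ Mhl).
  have Y0 : seq_of_row y 0 = x 0 ord0 - g 0 0 / (f 0%N)%:C.
    by rewrite (seq_of_rowE y ord0) mxE.
  have Y1 : seq_of_row y 1 = x 0 ord0.
    by rewrite -(mul_inner y ord0) yx.
  have YN : seq_of_row y N = x 0 ord_max.
    by rewrite -(mul_inner y ord_max) yx.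
  have YN1 : seq_of_row y N.+1 = x 0 ord_max - g 0 1 / (f N)%:C.
    by rewrite (seq_of_rowE y ord_max) mxE /= eqxx.
  have gE : flux (seq_of_row y) = g.
    apply/rowP => k; rewrite mxE Y0 Y1 YN YN1.
    case: k => [[|[|//]] k2] /=.
      rewrite (_ : Ordinal k2 = 0); last exact/val_inj.
      by rewrite opprB addrC subrK mulrCA mulfV // mulr1.
    rewrite (_ : Ordinal k2 = 1); last exact/val_inj.
    by rewrite addrAC subrr add0r mulrN opprK mulrCA mulfV // mulr1.
  rewrite gE yx; split=> //.
    rewrite /g mulmxBl addrA -HE xE lE subrr //.
  by exists (- t); rewrite mulNmx.
Qed.

(** * Comparison of the spectra of two boundary conditions *)

Definition spectral_data (h : 'M[C]_2) (l : 'cV[C]_2) (s : seq R) :=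
  exists2 P : 'M[C]_(N - (l != 0), N), pencil_basis weight_mx (form_mx h) P s &
    (P :=: kermx (ends *m l))%MS.

Lemma form_mxE h (x : 'rV[C]_N) : (x *m form_mx h *m x^t*) 0 0 =
  (x *m free_mx *m x^t*) 0 0 + (x *m ends *m h *m (x *m ends)^t*) 0 0.
Proof.
rewrite /form_mx mulmxDr mulmxDl mxE; congr (_ + _ 0 0).
by rewrite mul_trmxC ends_trC !mulmxA.
Qed.

(** The common part [free_mx] cancels, leaving a comparison on C^2. In the dimension count, each
    column of [k] and a constraint on the first problem cost one index. *)
Lemma spectral_data_le c h1 h2 l1 l2 s1 s2 (k : 'M[C]_(2, c)) i j :
  spectral_data h1 l1 s1 -> spectral_data h2 l2 s2 ->
  (forall b : 'rV[C]_2, b *m l1 = 0 -> b *m l2 = 0 -> b *m k = 0 ->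
     (b *m h1 *m b^t*) 0 0 <= (b *m h2 *m b^t*) 0 0) ->
  (i < N - (l1 != 0%R))%N -> (j < N - (l2 != 0%R))%N ->
  (c + (l1 != 0%R) + i <= j)%N ->
  nth 0 s1 i <= nth 0 s2 j.
Proof.
move=> [P1 B1 E1] [P2 B2 E2] h12 i1 j2 cij.
have le_x (x : 'rV[C]_N) : (x <= P1)%MS -> (x <= P2)%MS -> x *m (ends *m k) = 0 ->
    (x *m form_mx h1 *m x^t*) 0 0 <= (x *m form_mx h2 *m x^t*) 0 0.
  rewrite E1 E2 => /sub_kermxP + /sub_kermxP; rewrite !mulmxA => x1 x2 xk.
  have := h12 _ x1 x2 xk; rewrite (form_mxE h1) (form_mxE h2).
  by rewrite -(lerD2l ((x *m free_mx *m x^t*) 0 0)).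
have dims : (N + c < N - (l1 != 0%R) - i + j.+1)%N by lia.
exact: pencil_nth_le weight_pos B1 B2 le_x i1 j2 dims.
Qed.

(** The forms are ordered everywhere, which compares equal indices; on the hyperplane [b *m z = 0]
    they agree, which gives the reverse bound at the cost of one index. *)
Lemma rank_one_interlacing h1 h2 s1 s2 (z : 'cV[C]_2) (r : R) :
  spectral_data h1 0 s1 -> spectral_data h2 0 s2 ->
  (forall b : 'rV[C]_2, (b *m h2 *m b^t*) 0 0 =
     (b *m h1 *m b^t*) 0 0 + r%:C * `|(b *m z) 0 0| ^+ 2) ->
  0 <= r ->
  (forall i, (i <= N - 1)%N -> nth 0 s1 i <= nth 0 s2 i) /\
  (forall i, (i <= N - 2)%N -> nth 0 s2 i <= nth 0 s1 i.+1).
Proof.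
move=> d1 d2 h12 r0; split=> i iN.
  (* A matrix without columns imposes no extra condition, so no index is lost. *)
  apply: (spectral_data_le (k := 0 : 'M_(2, 0)) d1 d2) => [b _ _ _|||];
    rewrite ?eqxx; try lia.
  by rewrite h12 lerDl mulr_ge0 ?exprn_ge0 ?normr_ge0 ?ler0c.
apply: (spectral_data_le (k := z) d2 d1) => [b _ _ bz|||];
    rewrite ?eqxx; try lia.
by rewrite h12 bz [X in `|X|]mxE normr0 expr0n mulr0 addr0.
Qed.

(** Cauchy interlacing: only the bound with the constrained problem on the left loses an index. *)
Lemma constraint_interlacing h1 h2 l s1 s2 : l != 0 ->
  spectral_data h1 l s1 -> spectral_data h2 0 s2 ->
  (forall b : 'rV[C]_2, b *m l = 0 ->
     (b *m h1 *m b^t*) 0 0 = (b *m h2 *m b^t*) 0 0) ->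
  forall i, (i <= N - 2)%N -> nth 0 s2 i <= nth 0 s1 i <= nth 0 s2 i.+1.
Proof.
move=> l0 d1 d2 h12 i iN; apply/andP; split.
  apply: (spectral_data_le (k := 0 : 'M_(2, 0)) d2 d1) => [b _ bl _|||];
    rewrite ?l0 ?eqxx; try lia.
  by rewrite h12.
apply: (spectral_data_le (k := 0 : 'M_(2, 0)) d1 d2) => [b bl _ _|||];
    rewrite ?l0 ?eqxx; try lia.
by rewrite h12.
Qed.

Lemma spectral_data_exists M h l : h^t* = h -> bc_form M h l ->
  exists s, [/\ eig_list N f q w M s, size s = (N - (l != 0%R))%N &
                spectral_data h l s].
Proof.
move=> hh /(sl_spectrum hh)[s [P [es PP Pl]]]; exists s.
by split=> //; [case: PP | exists P].
Qed.

End DiscreteSturmLiouville.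

(** * The boundary forms of K, S and V *)

Section Vectors2.
Variable C : numClosedFieldType.

Definition mx2 (a b c d : C) : 'M[C]_2 :=
  \matrix_(i, j) if i == 0 then (if j == 0 then a else b)
                 else if j == 0 then c else d.
Definition col2 (a b : C) : 'cV[C]_2 := \col_i if i == 0 then a else b.

Lemma col2_eq0 a b : (col2 a b == 0) = (a == 0) && (b == 0).
Proof.
apply/eqP/andP => [/colP e|[/eqP-> /eqP->]].
  by move: (e 0) (e 1); rewrite !mxE /= => -> ->.
by apply/colP => i; rewrite !mxE if_same.
Qed.

Lemma col2_0 : col2 0 0 = 0.
Proof. by apply/eqP; rewrite col2_eq0 eqxx. Qed.

Lemma mx2_herm a b c d : a^*%R = a -> b^*%R = c -> d^*%R = d ->
  (mx2 a b c d)^t* = mx2 a b c d.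
Proof.
move=> ha hb hd; apply/matrixP => i j; rewrite !mxE.
by do 2!case: (_ == 0) => //; rewrite -hb conjCK.
Qed.

Lemma mul_col2 (x : 'rV[C]_2) a b : (x *m col2 a b) 0 0 = x 0 0 * a + x 0 1 * b.
Proof.
rewrite mxE !big_ord_recl big_ord0 addr0 !mxE /=.
by rewrite (_ : lift ord0 ord0 = 1) //; exact/val_inj.
Qed.

Lemma mul_mx2 (x : 'rV[C]_2) a b c d k : (x *m mx2 a b c d) 0 k =
  if k == 0 then x 0 0 * a + x 0 1 * c else x 0 0 * b + x 0 1 * d.
Proof.
rewrite mxE !big_ord_recl big_ord0 addr0 !mxE /=.
by rewrite (_ : lift ord0 ord0 = 1); [case: ifP | exact/val_inj].
Qed.

Lemma mx2_form (x : 'rV[C]_2) a b c d :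
  (x *m mx2 a b c d *m x^t*) 0 0 = a * (x 0 0 * (x 0 0)^*%R) +
    b * (x 0 0 * (x 0 1)^*%R) + c * (x 0 1 * (x 0 0)^*%R) + d * (x 0 1 * (x 0 1)^*%R).
Proof.
rewrite mxE !big_ord_recl big_ord0 addr0 !mul_mx2 !mxE /=.
rewrite (_ : lift ord0 ord0 = 1); last exact/val_inj.
ring.
Qed.

Lemma mul_col2_eq0 (x : 'rV[C]_2) a b :
  x *m col2 a b = 0 <-> x 0 0 * a + x 0 1 * b = 0.
Proof.
rewrite -mul_col2; split=> [->|x0]; first by rewrite mxE.
by apply/rowP => k; rewrite ord1 x0 mxE.
Qed.

End Vectors2.

(** Scalar version of [bc_form], which reduces each boundary condition to field identities. *)
Lemma bc_form2 (R : realType) (f : nat -> R) (M : 'M[R[i]]_(2, 4))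
    (a b c d al be : R[i]) :
  (forall p u z v : R[i], let x := p + u / (f 0%N)%:C in
    (M 0 (inord 0) * p + M 0 (inord 1) * u
      + M 0 (inord 2) * z + M 0 (inord 3) * v = 0 /\
     M 1 (inord 0) * p + M 1 (inord 1) * u
      + M 1 (inord 2) * z + M 1 (inord 3) * v = 0) <->
    (x * al + z * be = 0 /\ exists t : R[i],
      u = x * a + z * c + t * al^*%R /\ - v = x * b + z * d + t * be^*%R)) ->
  bc_form f M (mx2 a b c d) (col2 al be).
Proof.
move=> H p u z v; have {H} := H p u z v; rewrite /=.
set X := p + _ / _; set b' := \row_k _; set g := \row_k _ => H.
have r2 (Q : 'I_2 -> Prop) : (forall r, Q r) <-> Q 0 /\ Q 1.
  split=> [//|[Q0 Q1] [[|[|//]] k2]].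
    by rewrite (_ : Ordinal k2 = 0) //; exact/val_inj.
  by rewrite (_ : Ordinal k2 = 1) //; exact/val_inj.
have bl : b' *m col2 al be = 0 <-> X * al + z * be = 0.
  by rewrite mul_col2_eq0 !mxE.
have gE (t : 'rV[R[i]]_1) : g = b' *m mx2 a b c d + t *m (col2 al be)^t* <->
    u = X * a + z * c + t 0 0 * al^*%R /\ - v = X * b + z * d + t 0 0 * be^*%R.
  have E k : (b' *m mx2 a b c d + t *m (col2 al be)^t* ) 0 k =
      if k == 0 then X * a + z * c + t 0 0 * al^*%R
      else X * b + z * d + t 0 0 * be^*%R.
    by rewrite mxE mul_mx2 [X in _ + X]mxE big_ord1 !mxE /=; case: ifP.
  rewrite -rowP; split=> [e|[e0 e1]].
    by have := e 0; have := e 1; rewrite !E !mxE /=.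
  by move=> k; rewrite E mxE; case: ifP.
rewrite r2 H bl; split=> -[x0 [t tE]]; split=> //.
  by exists (const_mx t); apply/gE; rewrite mxE.
by exists (t 0 0); apply/gE.
Qed.

Lemma norm_expi (R : realType) (g : R) : `|expi g| = 1.
Proof. by rewrite normc_def /= cos2Dsin2 sqrtr1. Qed.

Lemma expi_neq0 (R : realType) (g : R) : expi g != 0.
Proof. by rewrite -normr_eq0 norm_expi oner_eq0. Qed.

Lemma expi_conj (R : realType) (g : R) : (expi g)^*%R = (expi g)^-1.
Proof.
apply: (mulfI (expi_neq0 g)).
by rewrite mulfV ?expi_neq0 // -normCK norm_expi expr1n.
Qed.

Lemma bcKE (R : realType) (K : 'M[R]_2) g (r : 'I_2) :
  [/\ bcK K g r (inord 0) = expi g * (K r 0)%:C,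
      bcK K g r (inord 1) = expi g * (K r 1)%:C,
      bcK K g r (inord 2) = - (r == 0)%:R &
      bcK K g r (inord 3) = - (r == 1)%:R].
Proof.
have i0 : inord 0 = lshift 2 (0 : 'I_2) :> 'I_4 by apply/val_inj; rewrite /= inordK.
have i1 : inord 1 = lshift 2 (1 : 'I_2) :> 'I_4 by apply/val_inj; rewrite /= inordK.
have i2 : inord 2 = rshift 2 (0 : 'I_2) :> 'I_4 by apply/val_inj; rewrite /= inordK.
have i3 : inord 3 = rshift 2 (1 : 'I_2) :> 'I_4 by apply/val_inj; rewrite /= inordK.
rewrite i0 i1 i2 i3; split.
- by apply: etrans (row_mxEl _ _ _ _) _; rewrite !mxE.
- by apply: etrans (row_mxEl _ _ _ _) _; rewrite !mxE.
- by apply: etrans (row_mxEr _ _ _ _) _; rewrite !mxE.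
- by apply: etrans (row_mxEr _ _ _ _) _; rewrite !mxE.
Qed.

Definition bc_row (R : realType) (M : 'M[R[i]]_(2, 4)) (p u z v : R[i]) r :=
  M r (inord 0) * p + M r (inord 1) * u + M r (inord 2) * z + M r (inord 3) * v.

Lemma bcK_rows (R : realType) (K : 'M[R]_2) g p u z v :
  (bc_row (bcK K g) p u z v 0 = 0 /\ bc_row (bcK K g) p u z v 1 = 0) <->
  (z = expi g * ((K 0 0)%:C * p + (K 0 1)%:C * u) /\
   v = expi g * ((K 1 0)%:C * p + (K 1 1)%:C * u)).
Proof.
rewrite /bc_row; have [-> -> -> ->] := bcKE K g 0.
have [-> -> -> ->] := bcKE K g 1.
rewrite (_ : (0 == 1 :> 'I_2) = false) // (_ : (1 == 0 :> 'I_2) = false) //.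
rewrite !eqxx /=; split=> -[E1 E2]; split.
- by apply/esym/eqP; rewrite -subr_eq0; apply/eqP; rewrite -[RHS]E1; ring.
- by apply/esym/eqP; rewrite -subr_eq0; apply/eqP; rewrite -[RHS]E2; ring.
- by rewrite E1; ring.
- by rewrite E2; ring.
Qed.

Lemma mx24_row (R : realType) (a b c d a' b' c' d' : R) p u z v :
  bc_row (mx24 a b c d a' b' c' d') p u z v 0
    = a%:C * p + b%:C * u + c%:C * z + d%:C * v /\
  bc_row (mx24 a b c d a' b' c' d') p u z v 1
    = a'%:C * p + b'%:C * u + c'%:C * z + d'%:C * v.
Proof. by rewrite /bc_row !mxE !inordK. Qed.

Lemma det2 (A : comNzRingType) (K : 'M[A]_2) :
  \det K = K 0 0 * K 1 1 - K 0 1 * K 1 0.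
Proof.
rewrite (expand_det_row _ 0) !big_ord_recl big_ord0 addr0.
rewrite /cofactor !det_mx11 !mxE /= expr0 expr1 mul1r mulN1r mulrN.
by congr (_ * K _ _ - K _ _ * K _ _); exact/val_inj.
Qed.

Section BoundaryForms.
Variables (R : realType) (f : nat -> R) (K : 'M[R]_2) (g : R).
Hypothesis f0N0 : f 0%N != 0.
Hypothesis detK : \det K = 1.
Local Notation F := ((f 0%N)%:C : R[i]).
Local Notation k11 := ((K 0 0)%:C : R[i]).
Local Notation k12 := ((K 0 1)%:C : R[i]).
Local Notation k21 := ((K 1 0)%:C : R[i]).
Local Notation k22 := ((K 1 1)%:C : R[i]).
Local Notation cc := (k11 - F * k12).
Local Notation dd := (F * k22 - k21).
Local Notation e := (expi g).

Let F0 : F != 0. Proof. by rewrite fmorph_eq0. Qed.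

Let e0 : e != 0 := expi_neq0 g.

(** Stated with a monomial on the left, to serve as a rewriting rule for [field]. *)
Let detC : k11 * k22 = 1 + k12 * k21.
Proof.
move: detK; rewrite det2 => /eqP; rewrite subr_eq => /eqP dK.
by rewrite -!rmorphM /= dK rmorphD rmorph1.
Qed.

(* The suffix 0 marks the degenerate cases: [cc = 0] for K, [k12 = 0] for S,
   [dd = 0] for V. *)
Definition hK :=
  mx2 (F * k11 / cc) (- (F * e / cc)) (- (F * e^-1 / cc)) (dd / cc).

(** With p = x_1 - u / F the first row reads z = e (k11 x_1 - (cc / F) u), which is solved for u;
    the second row, v = e (k21 x_1 + (dd / F) u), then gives v, simplified by k11 dd + k21 cc =
    F. *)
Lemma bcK_form : cc != 0 -> bc_form f (bcK K g) hK 0.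
Proof.
move=> c0; rewrite -col2_0; apply: bc_form2 => p u z v x; apply: iff_trans (bcK_rows _ _ _ _ _ _) _.
rewrite !mulr0 addr0 conjC0 {}/x.
split=> [[-> ->]|[_ [t [uE vE]]]].
  by split=> //; exists 0; split; field: detC; do ?[apply/andP; split].
have uE' : u - ((p + u / F) * (F * k11 / cc) + z * - (F * e^-1 / cc)) = 0.
  by rewrite [X in X - _]uE mulr0 addr0 subrr.
have vE' : v = - ((p + u / F) * - (F * e / cc) + z * (dd / cc)).
  by rewrite -[LHS]opprK vE mulr0 addr0.
split; apply/eqP; rewrite -subr_eq0; apply/eqP.
  (* The factors [cc * e / F] here and [dd * e / F] below are, up to sign, the coefficients of u in
     the two rows once p is eliminated. *)
  transitivity (- (cc * e / F) *
      - (u - ((p + u / F) * (F * k11 / cc) + z * - (F * e^-1 / cc)))).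
    by field; do ?[apply/andP; split].
  by rewrite uE' oppr0 mulr0.
rewrite vE'; transitivity (- (dd * e / F) *
    (u - ((p + u / F) * (F * k11 / cc) + z * - (F * e^-1 / cc)))).
  by field: detC; do ?[apply/andP; split].
by rewrite uE' mulr0.
Qed.

Definition hK0 := mx2 (- (k11 * k21)) 0 0 0.
Definition lK0 := col2 k11 (- e^-1).

Lemma k12_neq0 : cc = 0 -> k12 != 0.
Proof.
move=> c0; apply: contra_eq_neq detC => k0.
move/eqP: c0; rewrite k0 mulr0 subr0 => /eqP->.
by rewrite !mul0r addr0 eq_sym oner_eq0.
Qed.

Lemma k22_neq0 : dd = 0 \/ k12 = 0 -> k22 != 0.
Proof.
move=> H; apply: contra_eq_neq detC => k0; rewrite k0 mulr0.
case: H => [/eqP|->]; last by rewrite mul0r addr0 eq_sym oner_eq0.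
rewrite k0 mulr0 sub0r oppr_eq0 => /eqP->.
by rewrite mulr0 addr0 eq_sym oner_eq0.
Qed.

(** Now u drops out of the first row, which becomes the constraint z = e k11 x_1. The second flux
    forces the multiplier t = v / e, and k12 dd = 1 then turns the equation for u into the
    coefficient - k11 k21 of x_1. *)
Lemma bcK0_form : cc = 0 -> bc_form f (bcK K g) hK0 lK0.
Proof.
move=> c0; have k12N0 := k12_neq0 c0.
have k11E : k11 = F * k12 by apply/eqP; rewrite -subr_eq0 c0.
have detF : F * k12 * k22 = 1 + k12 * k21 by rewrite -k11E detC.
have eC : (- e^-1)^*%R = - e by rewrite rmorphN fmorphV /= expi_conj invrK.
apply: bc_form2 => p u z v x; apply: iff_trans (bcK_rows _ _ _ _ _ _) _.
rewrite !mulr0 eC conjC_real_complex k11E {}/x.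
split=> [[-> ->]|[lE [t [uE vE]]]].
  split; first by field; do ?[apply/andP; split].
  exists (u / (F * k12) + k21 * (p + u / F)).
  by split; field: detF; do ?[apply/andP; split].
have zE : z = e * (F * k12 * p + k12 * u).
  apply/eqP; rewrite -subr_eq0; apply/eqP.
  transitivity (- e * ((p + u / F) * (F * k12) + z * - e^-1)).
    by field; do ?[apply/andP; split].
  by rewrite lE mulr0.
split=> //.
have tE : t = u / (F * k12) + k21 * (p + u / F).
  apply/eqP; rewrite -subr_eq0; apply/eqP.
  transitivity
    (- ((u - ((p + u / F) * - (F * k12 * k21) + 0 + t * (F * k12))) / (F * k12))).
    by field; do ?[apply/andP; split].
  by rewrite -uE subrr mul0r oppr0.
rewrite -[LHS]opprK vE tE.
by field: detF; do ?[apply/andP; split].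
Qed.

(** The condition y_0 = 0 means u = F x_1. The second row gives v = (k22 / k12) z, or z = 0 with v
    left to the multiplier when k12 = 0. *)
Definition hS := mx2 F 0 0 (- (k22 / k12)).
Definition hS0 := mx2 F 0 0 (0 : R[i]).

Lemma bcS_form : k12 != 0 -> bc_form f (bcS K) hS 0.
Proof.
move=> k0; rewrite -col2_0; apply: bc_form2 => p u z v x.
have [R0 R1] := mx24_row 1 0 0 0 0 0 (- K 1 1) (K 0 1) p u z v.
rewrite -/(bc_row (bcS K) p u z v 0) -/(bc_row (bcS K) p u z v 1).
rewrite R0 R1 !rmorph0 !rmorph1 !mul0r !mul1r ?mulr0 ?addr0 ?add0r {}/x.
rewrite rmorphN /=; split=> [[-> vE]|[_ [t [uE vE]]]].
  split=> //; exists 0; rewrite mulr0 ?addr0 ?add0r; split; first by field.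
  have -> : v = z * (k22 / k12) + (- k22 * z + k12 * v) / k12 by field.
  by rewrite vE; ring.
move: uE vE; rewrite ?mulr0 ?addr0 ?add0r => uE vE; split.
  transitivity (((p + u / F) * F - u) / F); first by field.
  by rewrite -uE subrr mul0r.
by rewrite -[v]opprK vE; field.
Qed.

Lemma bcS0_form : k12 = 0 -> bc_form f (bcS K) hS0 (col2 0 1).
Proof.
move=> k0; have k220 := k22_neq0 (or_intror k0).
apply: bc_form2 => p u z v x.
have [R0 R1] := mx24_row 1 0 0 0 0 0 (- K 1 1) (K 0 1) p u z v.
rewrite -/(bc_row (bcS K) p u z v 0) -/(bc_row (bcS K) p u z v 1).
rewrite R0 R1 k0 !rmorph0 !rmorph1 !mul0r !mul1r !mulr1 ?mulr0 ?addr0 ?add0r {}/x.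
rewrite rmorphN /=; split=> [[-> /eqP]|[zE [t [uE vE]]]].
  rewrite mulf_eq0 oppr_eq0 (negPf k220) /= => /eqP->; split=> //; exists (- v).
  by split; [field | ring].
move: uE; rewrite ?mulr0 ?addr0 => uE; split; last by rewrite zE mulr0.
transitivity (((p + u / F) * F - u) / F); first by field.
by rewrite -uE subrr mul0r.
Qed.

(** Here v = 0, and eliminating p from k21 p + k22 u = 0 leaves k21 x_1 + (dd / F) u = 0; for dd = 0
    this is the constraint x_1 = 0. *)
Definition hV := mx2 (- (k21 * F / dd)) 0 0 (0 : R[i]).
Definition hV0 := mx2 (0 : R[i]) 0 0 0.

Lemma bcV_form : dd != 0 -> bc_form f (bcV K) hV 0.
Proof.
move=> d0; rewrite -col2_0; apply: bc_form2 => p u z v x.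
have [R0 R1] := mx24_row (K 1 0) (K 1 1) 0 0 0 0 0 1 p u z v.
rewrite -/(bc_row (bcV K) p u z v 0) -/(bc_row (bcV K) p u z v 1).
rewrite R0 R1 !rmorph0 !rmorph1 !mul0r !mul1r ?mulr0 ?addr0 ?add0r {}/x.
split=> [[pE ->]|[_ [t [uE vE]]]].
  split=> //; exists 0; rewrite ?mulr0 ?addr0 oppr0; split=> //.
  apply/eqP; rewrite -subr_eq0; apply/eqP.
  transitivity ((k21 * p + k22 * u) * (F / dd)).
    by field; do ?[apply/andP; split].
  by rewrite pE mul0r.
move: uE vE; rewrite ?mulr0 ?addr0 => uE vE; split; last first.
  by apply/eqP; rewrite -oppr_eq0 vE.
transitivity ((u - (p + u / F) * - (k21 * F / dd)) * (dd / F)).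
  by field; do ?[apply/andP; split].
by rewrite -uE subrr mul0r.
Qed.

Lemma bcV0_form : dd = 0 -> bc_form f (bcV K) hV0 (col2 1 0).
Proof.
move=> d0; have k220 := k22_neq0 (or_introl d0).
have k21E : k21 = F * k22 by apply/eqP; rewrite eq_sym -subr_eq0 d0.
apply: bc_form2 => p u z v x.
have [R0 R1] := mx24_row (K 1 0) (K 1 1) 0 0 0 0 0 1 p u z v.
rewrite -/(bc_row (bcV K) p u z v 0) -/(bc_row (bcV K) p u z v 1).
rewrite R0 R1 !rmorph0 !rmorph1 !mul0r !mul1r !mulr1 ?mulr0 ?addr0 ?add0r {}/x.
rewrite k21E; split=> [[pE ->]|[xE [t [uE vE]]]].
  split; last by exists u; split; ring.
  transitivity ((F * k22 * p + k22 * u) / (F * k22)).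
    by field; do ?[apply/andP; split].
  by rewrite pE mul0r.
split; last by apply/eqP; rewrite -oppr_eq0 vE; apply/eqP; ring.
transitivity ((p + u / F) * (F * k22)); first by field.
by rewrite xE mul0r.
Qed.

(** * Symmetry and comparison of the boundary forms *)

Lemma boundary_forms_herm :
  [/\ hK^t* = hK, hK0^t* = hK0, hS^t* = hS & hS0^t* = hS0] /\
  hV^t* = hV /\ hV0^t* = hV0.
Proof.
by split; [split | split]; apply: mx2_herm;
  rewrite ?(rmorphN, rmorphM, rmorphB, fmorphV, rmorph0) /=
    ?(rmorphN, rmorphM, rmorphB, fmorphV, rmorph0) /=
    ?(conjC_real_complex, expi_conj, invrK).
Qed.

(** The difference of the two matrices has determinant zero by cc k22 + k12 dd = 1, hence is a
    multiple of one square. *)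
Lemma hKS_form (x : 'rV[R[i]]_2) : cc != 0 -> k12 != 0 ->
  (x *m hK *m x^t*) 0 0 = (x *m hS *m x^t*) 0 0
    + (cc * k12)^-1 * `|(x *m col2 (F * k12) (- e^-1)) 0 0| ^+ 2.
Proof.
move=> c0 k0; rewrite !mx2_form normCK mul_col2.
rewrite rmorphD !rmorphM rmorphN fmorphV /= !conjC_real_complex expi_conj invrK.
by field: detC; do ?[apply/andP; split].
Qed.

(** As for [hKS_form], now with k11 dd + k21 cc = F. *)
Lemma hKV_form (x : 'rV[R[i]]_2) : cc != 0 -> dd != 0 ->
  (x *m hK *m x^t*) 0 0 = (x *m hV *m x^t*) 0 0
    + (cc * dd)^-1 * `|(x *m col2 F (- (dd * e^-1))) 0 0| ^+ 2.
Proof.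
move=> c0 d0; rewrite !mx2_form normCK mul_col2.
rewrite rmorphD !rmorphM rmorphN rmorphM rmorphB !rmorphM fmorphV /=.
rewrite !conjC_real_complex expi_conj invrK.
by field: detC; do ?[apply/andP; split].
Qed.

Lemma hKS0_form (x : 'rV[R[i]]_2) : k12 = 0 -> x *m col2 0 1 = 0 ->
  (x *m hK *m x^t*) 0 0 = (x *m hS0 *m x^t*) 0 0.
Proof.
move=> k0 /mul_col2_eq0; rewrite !mx2_form mulr0 add0r mulr1 => ->.
have k110 : k11 != 0.
  apply: contra_eq_neq detC => ->; rewrite k0 !mul0r addr0 eq_sym.
  exact: oner_neq0.
by rewrite k0 mulr0 subr0 conjC0; field; do ?[apply/andP; split].
Qed.

Lemma hKV0_form (x : 'rV[R[i]]_2) : dd = 0 -> x *m col2 1 0 = 0 ->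
  (x *m hK *m x^t*) 0 0 = (x *m hV0 *m x^t*) 0 0.
Proof.
move=> d0 /mul_col2_eq0; rewrite !mx2_form mulr0 addr0 mulr1 => ->.
by rewrite d0 conjC0; ring.
Qed.

Lemma lK0_end (x : 'rV[R[i]]_2) : x *m lK0 = 0 -> x 0 1 = e * k11 * x 0 0.
Proof.
move=> /mul_col2_eq0 xl; apply/eqP; rewrite -subr_eq0; apply/eqP.
by transitivity (- e * (x 0 0 * k11 + x 0 1 * - e^-1)); [field|rewrite xl mulr0].
Qed.

(** The phase disappears from |x_N|^2 = k11^2 |x_1|^2, and k11 = F k12 gives F - k11^2 k22 / k12 = -
    k11 k21. *)
Lemma hK0S_form (x : 'rV[R[i]]_2) : cc = 0 -> x *m lK0 = 0 ->
  (x *m hK0 *m x^t*) 0 0 = (x *m hS *m x^t*) 0 0.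
Proof.
move=> c0 /lK0_end xE; have k12N0 := k12_neq0 c0.
have k11E : k11 = F * k12 by apply/eqP; rewrite -subr_eq0 c0.
have detF : F * k12 * k22 = 1 + k12 * k21 by rewrite -k11E detC.
rewrite !mx2_form xE !rmorphM /= !conjC_real_complex expi_conj k11E.
by field: detF; do ?[apply/andP; split].
Qed.

Lemma hK0V_form (x : 'rV[R[i]]_2) : cc = 0 -> x *m lK0 = 0 ->
  (x *m hK0 *m x^t*) 0 0 = (x *m hV *m x^t*) 0 0.
Proof.
move=> c0 /lK0_end xE; have k12N0 := k12_neq0 c0.
have k11E : k11 = F * k12 by apply/eqP; rewrite -subr_eq0 c0.
have detF : F * k12 * k22 = 1 + k12 * k21 by rewrite -k11E detC.
have dE : dd = k12^-1.
  by apply: (mulfI k12N0); rewrite mulfV // mulrBr mulrA (mulrC k12) detF addrK.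
rewrite !mx2_form dE k11E invrK; ring.
Qed.

End BoundaryForms.

(** * Uniqueness of the eigenvalue list and assembly of the inequalities *)

Lemma eig_list_inj (R : realType) N (f q w : nat -> R) M (s1 s2 : seq R) :
  eig_list N f q w M s1 -> eig_list N f q w M s2 -> s1 = s2.
Proof.
move=> [ss1 c1] [ss2 c2]; apply: le_sorted_eq ss1 ss2 _.
apply/allP => x _ /=; apply/eqP.
have E s : count_mem x s = count (fun z : R => z%:C == x%:C) s.
  by apply: eq_count => z /=; rewrite (inj_eq (fmorph_inj _)).
by rewrite !E c1 c2.
Qed.

Local Close Scope complex_scope.

Theorem theorem3p7 (R : realType) (N : nat) (f q w : nat -> R)
    (K : 'M[R]_2) (gamma : R) :
  (2 <= N)%N ->
  (forall n, (n <= N)%N -> f n != 0) ->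
  (forall n, (1 <= n <= N)%N -> 0 < w n) ->
  \det K = 1 ->
  - pi < gamma <= pi ->
  let k11 := K 0 0 in let k12 := K 0 1 in
  let k21 := K 1 0 in let k22 := K 1 1 in
  let c := k11 - f 0%N * k12 in
  let d := f 0%N * k22 - k21 in
  exists sS sV : seq R,
    [/\ eig_list N f q w (bcS K) sS,
        size sS = (if k12 != 0 then N else (N - 1)%N),
        eig_list N f q w (bcV K) sV,
        size sV = (if d != 0 then N else (N - 1)%N) &
    forall sK : seq R, eig_list N f q w (bcK K gamma) sK ->
    let lK n := nth 0 sK n in
    let lS n := nth 0 sS n in
    let lV n := nth 0 sV n in
    (* (i) *)
    [/\ k12 = 0 ->
          forall n, (n <= N - 2)%N -> lK n <= lS n <= lK n.+1,
        c * k12 > 0 ->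
          (forall n, (n <= N - 1)%N -> lS n <= lK n) /\
          (forall n, (n <= N - 2)%N -> lK n <= lS n.+1),
        c * k12 < 0 ->
          (forall n, (n <= N - 1)%N -> lK n <= lS n) /\
          (forall n, (n <= N - 2)%N -> lS n <= lK n.+1) &
        c = 0 ->
          forall n, (n <= N - 2)%N -> lS n <= lK n <= lS n.+1] /\
    (* (ii) *)
    [/\ d = 0 ->
          forall n, (n <= N - 2)%N -> lK n <= lV n <= lK n.+1,
        c * d > 0 ->
          (forall n, (n <= N - 1)%N -> lV n <= lK n) /\
          (forall n, (n <= N - 2)%N -> lK n <= lV n.+1),
        c * d < 0 ->
          (forall n, (n <= N - 1)%N -> lK n <= lV n) /\
          (forall n, (n <= N - 2)%N -> lV n <= lK n.+1) &
        c = 0 ->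
          forall n, (n <= N - 2)%N -> lV n <= lK n <= lV n.+1]].
Proof.
case: N => [|[|n]] // _ fN0 w0 detK _ k11 k12 k21 k22 c d.
have f0 := fN0 0%N isT.
have [[hhK hhK0 hhS hhS0] [hhV hhV0]] := boundary_forms_herm f K gamma.
have cE : (k11%:C - (f 0%N)%:C * k12%:C)%C = c%:C%C :> R[i].
  by rewrite /c rmorphB rmorphM.
have dE : ((f 0%N)%:C * k22%:C - k21%:C)%C = d%:C%C :> R[i].
  by rewrite /d rmorphB rmorphM.
have spec := spectral_data_exists q fN0 w0.
have l01 : col2 0 1 != 0 :> 'cV[R[i]]_2 by rewrite col2_eq0 oner_eq0 andbF.
have l10 : col2 1 0 != 0 :> 'cV[R[i]]_2 by rewrite col2_eq0 oner_eq0.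
have [sS [eS szS dS dS0]] : exists sS : seq R,
    [/\ eig_list n.+2 f q w (bcS K) sS,
     size sS = (if k12 != 0 then n.+2 else (n.+2 - 1)%N),
     k12 != 0 -> spectral_data n f q w (hS f K) 0 sS &
     k12 = 0 -> spectral_data n f q w (hS0 f) (col2 0 1) sS].
  have [k0|k0] := eqVneq k12 0.
    have [|s [es sz ds]] := spec _ _ _ hhS0 (bcS0_form f0 detK _).
      by rewrite -/k12 k0.
    by exists s; rewrite sz l01.
  have [|s [es sz ds]] := spec _ _ _ hhS (bcS_form f0 _).
    by rewrite fmorph_eq0.
  by exists s; split=> //= [|k1]; rewrite ?sz ?eqxx //; rewrite k1 eqxx in k0.
have [sV [eV szV dV dV0]] : exists sV : seq R,
    [/\ eig_list n.+2 f q w (bcV K) sV,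
     size sV = (if d != 0 then n.+2 else (n.+2 - 1)%N),
     d != 0 -> spectral_data n f q w (hV f K) 0 sV &
     d = 0 -> spectral_data n f q w (hV0 R) (col2 1 0) sV].
  have [d0|d0] := eqVneq d 0.
    have [|s [es sz ds]] := spec _ _ _ hhV0 (bcV0_form f0 detK _).
      by rewrite dE d0.
    by exists s; rewrite sz l10.
  have [|s [es sz ds]] := spec _ _ _ hhV (bcV_form f0 _).
    by rewrite dE fmorph_eq0.
  by exists s; split=> //= [|d1]; rewrite ?sz ?eqxx //; rewrite d1 eqxx in d0.
exists sS, sV; split=> // sK eK lK lS lV.
(* The list [sK] is arbitrary; by uniqueness it is the one built from the pencil and inherits its
   spectral data. *)
have dK : c != 0 -> spectral_data n f q w (hK f K gamma) 0 sK.
  move=> c0; have [|s [es _ ds]] := spec _ _ _ hhK (bcK_form gamma f0 detK _).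
    by rewrite cE fmorph_eq0.
  by rewrite (eig_list_inj eK es).
have dK0 : c = 0 -> spectral_data n f q w (hK0 K) (lK0 K gamma) sK.
  move=> c0; have [|s [es _ ds]] := spec _ _ _ hhK0 (bcK0_form gamma f0 detK _).
    by rewrite cE c0.
  by rewrite (eig_list_inj eK es).
have lK00 : lK0 K gamma != 0.
  by rewrite col2_eq0 oppr_eq0 invr_eq0 (negPf (expi_neq0 _)) andbF.
pose above (s : seq R) :=
  (forall i, (i <= n.+2 - 1)%N -> nth 0 s i <= nth 0 sK i) /\
  (forall i, (i <= n.+2 - 2)%N -> nth 0 sK i <= nth 0 s i.+1).
pose below (s : seq R) :=
  (forall i, (i <= n.+2 - 1)%N -> nth 0 sK i <= nth 0 s i) /\
  (forall i, (i <= n.+2 - 2)%N -> nth 0 s i <= nth 0 sK i.+1).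
(* For r < 0 the two problems exchange roles, and the perturbation becomes the nonnegative
   [- r^-1]. *)
have rank1 h (s : seq R) (z : 'cV_2) (r : R) :
    spectral_data n f q w h 0 s -> c != 0 ->
    (forall b : 'rV[R[i]]_2, (b *m hK f K gamma *m b^t*) 0 0 =
      (b *m h *m b^t*) 0 0 + (r%:C%C)^-1 * `|(b *m z) 0 0| ^+ 2) ->
    (0 < r -> above s) /\ (r < 0 -> below s).
  move=> ds c0 hE; rewrite -fmorphV in hE; split=> r0.
    by apply: (rank_one_interlacing w0 ds (dK c0) hE); rewrite invr_ge0 ltW.
  apply: (rank_one_interlacing (z := z) (r := - r^-1) w0 (dK c0) ds) => [b|].
    by rewrite hE rmorphN mulNr addrK.
  by rewrite oppr_ge0 invr_le0 ltW.
have KS : c * k12 != 0 -> (0 < c * k12 -> above sS) /\ (c * k12 < 0 -> below sS).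
  rewrite mulf_eq0 negb_or => /andP[c0 k0]; apply: (rank1 _ _ _ _ (dS k0) c0) => b.
  have cN : (k11%:C - (f 0%N)%:C * k12%:C)%C != 0 :> R[i].
    by rewrite cE fmorph_eq0.
  have kN : k12%:C%C != 0 :> R[i] by rewrite fmorph_eq0.
  by rewrite (hKS_form gamma detK b cN kN) cE rmorphM.
have KV : c * d != 0 -> (0 < c * d -> above sV) /\ (c * d < 0 -> below sV).
  rewrite mulf_eq0 negb_or => /andP[c0 d0]; apply: (rank1 _ _ _ _ (dV d0) c0) => b.
  have cN : (k11%:C - (f 0%N)%:C * k12%:C)%C != 0 :> R[i].
    by rewrite cE fmorph_eq0.
  have dN : ((f 0%N)%:C * k22%:C - k21%:C)%C != 0 :> R[i].
    by rewrite dE fmorph_eq0.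
  by rewrite (hKV_form gamma detK b cN dN) cE dE rmorphM.
(* Consequently c vanishes together with neither k12 nor d, so in each degenerate case only one of
   the two problems is constrained. *)
have cd1 : c * k22 + k12 * d = 1.
  by rewrite -detK det2 /c /d -/k11 -/k12 -/k21 -/k22; ring.
split; split.
- move=> k0; have c0 : c != 0.
    by apply: contra_eq_neq cd1 => ->; rewrite k0 !mul0r addr0 eq_sym oner_eq0.
  apply: (constraint_interlacing w0 l01 (dS0 k0) (dK c0)) => b bl.
  by apply/esym/hKS0_form => //; rewrite -/k12 k0.
- by move=> r0; case: KS => [|H _]; [rewrite gt_eqF | exact: H].
- by move=> r0; case: KS => [|_ H]; [rewrite lt_eqF | exact: H].
(* For c = 0 the constraint sits on the K side, which reverses the roles in the Cauchy
   interlacing. *)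
- move=> c0; have k0 : k12 != 0.
    by apply: contra_eq_neq cd1 => ->; rewrite c0 !mul0r addr0 eq_sym oner_eq0.
  apply: (constraint_interlacing w0 lK00 (dK0 c0) (dS k0)) => b bl.
  by apply: (hK0S_form detK _ bl); rewrite cE c0.
- move=> d0; have c0 : c != 0.
    by apply: contra_eq_neq cd1 => ->; rewrite d0 mul0r mulr0 addr0 eq_sym oner_eq0.
  apply: (constraint_interlacing w0 l10 (dV0 d0) (dK c0)) => b bl.
  by apply/esym/hKV0_form => //; rewrite dE d0.
- by move=> r0; case: KV => [|H _]; [rewrite gt_eqF | exact: H].
- by move=> r0; case: KV => [|_ H]; [rewrite lt_eqF | exact: H].
- move=> c0; have d0 : d != 0.
    by apply: contra_eq_neq cd1 => ->; rewrite c0 mul0r mulr0 addr0 eq_sym oner_eq0.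
  apply: (constraint_interlacing w0 lK00 (dK0 c0) (dV d0)) => b bl.
  by apply: (hK0V_form detK _ bl); rewrite cE c0.
Qed.
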